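(* Consider the AC optimal transmission switching problem (OTS) and the OTS algorithm described in the context. If $OPF(x)$ is solved by a local solution method (so that $OPF(x)$ is the objective value of some feasible, not necessarily globally optimal, solution of OTS with its binary vector fixed to $x$), then upon termination of the algorithm $$LB_1\ \le\ z^*\ \le\ UB,$$ where $z^*$ is the optimal value of OTS.
   Context: **Network data.** A power network $(\mathcal{B},\mathcal{L})$ has a finite set of buses $\mathcal{B}$, a finite set of lines $\mathcal{L}$, and generator buses $\mathcal{G}\subseteq\mathcal{B}$; $\delta(i)$ is the set of neighbors of bus $i$. Data: real numbers $G_{ij}=G_{ji}$, $B_{ij}=B_{ji}$ for each line, shunt parameters $g_{ii},b_{ii}$, loads $p_i^d,q_i^d$, voltage bounds $\underline V_i,\overline V_i$ with $0<\underline V_i\le\overline V_i$, generation bounds $p_i^{\min},p_i^{\max},q_i^{\min},q_i^{\max}$, line limits $S_{ij}^{\max}$, and cost functions $C_i$ (linear or convex quadratic). At buses without a generator $p_i^g=q_i^g=0$. Flow constraints ''for $(i,j)\in\mathcal{L}$'' are imposed for both orientations of a line; there is a single binary variable per line, $x_{ij}=x_{ji}$. **OTS (exact problem).** Minimize $\sum_{i\in\mathcal{G}}C_i(p_i^g)$ over $p^g,q^g,p,q,c,s,\theta,x$ subject to - for $i\in\mathcal{B}$: $p_i^g-p_i^d=g_{ii}c_{ii}+\sum_{j\in\delta(i)}p_{ij}$, $\;q_i^g-q_i^d=-b_{ii}c_{ii}+\sum_{j\in\delta(i)}q_{ij}$, $\;\underline V_i^2\le c_{ii}\le\overline V_i^2$;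 - for $i\in\mathcal{G}$: $p_i^{\min}\le p_i^g\le p_i^{\max}$, $\;q_i^{\min}\le q_i^g\le q_i^{\max}$; - for $(i,j)\in\mathcal{L}$: $p_{ij}^2+q_{ij}^2\le(S_{ij}^{\max})^2$, $\;c_{ij}=c_{ji}$, $\;s_{ij}=-s_{ji}$, $\;x_{ij}\in\{0,1\}$; - for $(i,j)\in\mathcal{L}$: $p_{ij}=(-G_{ij}c_{ii}+G_{ij}c_{ij}-B_{ij}s_{ij})x_{ij}$, $\;q_{ij}=(B_{ij}c_{ii}-B_{ij}c_{ij}-G_{ij}s_{ij})x_{ij}$; - for $(i,j)\in\mathcal{L}$: $(c_{ij}^2+s_{ij}^2-c_{ii}c_{jj})x_{ij}=0$, $\;(\theta_j-\theta_i-\operatorname{atan2}(s_{ij},c_{ij}))x_{ij}=0$. Its optimal value is $z^*$ ($+\infty$ if infeasible). A topology is a binary vector $x$. $OPF(x)$ denotes the objective value of a feasible solution of OTS with the binary vector fixed to $x$ ($+\infty$ if none is found or none exists). **MISOCP relaxation.** Let $\underline c_{ii}=\underline V_i^2$, $\overline c_{ii}=\overline V_i^2$, and let $\underline c_{ij},\overline c_{ij},\underline s_{ij},\overline s_{ij}$ be finite bounds on $c_{ij},s_{ij}$ valid for every OTS-feasible solution in which line $(i,j)$ is on. In the relaxation $c_{ij},s_{ij}$ take the same values as before when the line is on and $0$ when it is off, and there are additional variables $c_{ii}^j$ (representing $c_{ii}x_{ij}$). Minimize $\sum_{i\in\mathcal{G}}C_i(p_i^g)$ subject to the first three groups of constraints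 above together with, for $(i,j)\in\mathcal{L}$, - $p_{ij}=-G_{ij}c_{ii}^j+G_{ij}c_{ij}-B_{ij}s_{ij}$, $\;q_{ij}=B_{ij}c_{ii}^j-B_{ij}c_{ij}-G_{ij}s_{ij}$; - $\underline c_{ij}x_{ij}\le c_{ij}\le\overline c_{ij}x_{ij}$, $\;\underline s_{ij}x_{ij}\le s_{ij}\le\overline s_{ij}x_{ij}$, $\;\underline c_{ii}x_{ij}\le c_{ii}^j\le\overline c_{ii}x_{ij}$; - $c_{ii}-\overline c_{ii}(1-x_{ij})\le c_{ii}^j\le c_{ii}-\underline c_{ii}(1-x_{ij})$; - $c_{ij}^2+s_{ij}^2\le c_{ii}^jc_{jj}^i$. $MISOCP(\mathcal{V},\mathcal{F})$ is this relaxation with additionally a finite set $\mathcal{V}$ of linear inequalities in $(c,s,x)$ and, for each forbidden topology $x^*\in\mathcal{F}$, the no-good cut $\sum_{(i,j):x^*_{ij}=1}(1-x_{ij})+\sum_{(i,j):x^*_{ij}=0}x_{ij}\ge1$. $SOCP(\mathcal{V})$ is the continuous relaxation ($0\le x_{ij}\le1$) of $MISOCP(\mathcal{V},\emptyset)$. **OTS algorithm.** Inputs $T_1,T_2,\epsilon$. *Phase I:* set $\mathcal{V}=\emptyset$, $\mathcal{F}=\emptyset$, $UB=\infty$. For $\tau=1,\dots,T_1$: solve $SOCP(\mathcal{V})$; for each cycle in a cycle basis of the network, separate inequalities cutting off its solution, giving a finite set $\mathcal{V}_\tau$; set $\mathcal{V}\leftarrow\mathcal{V}\cup\mathcal{V}_\tau$.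 All separated inequalities are valid for OTS: every OTS-feasible solution, with $c_{ij},s_{ij}$ set to $0$ on lines that are off, satisfies them. *Phase II:* set $t=0$ and repeat: $t\leftarrow t+1$; solve $MISOCP(\mathcal{V},\mathcal{F})$, obtaining its optimal value $LB_t$ and the set $\mathcal{P}_t$ of all integral solutions (topologies) found by the solver, which includes the topology of an optimal solution (if $MISOCP(\mathcal{V},\mathcal{F})$ is infeasible, $LB_t=+\infty$ and $\mathcal{P}_t=\emptyset$); for each $x\in\mathcal{P}_t$, if $OPF(x)<UB$ set $UB\leftarrow OPF(x)$ and record the corresponding solution; set $\mathcal{F}\leftarrow\mathcal{F}\cup\mathcal{P}_t$; until $LB_t\ge(1-\epsilon)UB$ or $t\ge T_2$. Thus $LB_1$ is the optimal value of $MISOCP(\mathcal{V},\emptyset)$ with $\mathcal{V}$ the set produced by Phase I. *)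

(* Defs.v *)
From HB Require Import structures.
From mathcomp Require Import all_boot all_order all_algebra.
From mathcomp Require Import all_classical all_reals all_analysis.

Set Implicit Arguments.
Unset Strict Implicit.
Unset Printing Implicit Defensive.

Import Order.TTheory GRing.Theory Num.Theory.
Local Open Scope classical_set_scope.
Local Open Scope ring_scope.

Definition atan2 (R : realType) (y x : R) : R :=
  if 0 < x then atan (y / x)
  else if x < 0 then (if 0 <= y then atan (y / x) + pi else atan (y / x) - pi)
  else if 0 < y then pi / 2
  else if y < 0 then - (pi / 2)
  else 0.

(* A line is given by the two-element set of its end buses, and distinct lines
   have distinct ends, so that a line is the same thing as an unordered pair
   of buses.  Per-line data with [a_ij = a_ji] are functions of the line. *)
Record network (R : realType) := Network {
  bus : finType;
  line : finType;
  ends : line -> {set bus};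
  ends_card : forall l, #|ends l| = 2%N;
  ends_inj : injective ends;
  gen : {set bus};
  condG : line -> R;
  suscB : line -> R;
  gshunt : bus -> R;
  bshunt : bus -> R;
  pload : bus -> R;
  qload : bus -> R;
  vmin : bus -> R;
  vmax : bus -> R;
  vmin_gt0 : forall i, 0 < vmin i;
  vmin_le_vmax : forall i, vmin i <= vmax i;
  pmin : bus -> R;
  pmax : bus -> R;
  qmin : bus -> R;
  qmax : bus -> R;
  smax : bus -> bus -> R;
  gencost : bus -> {poly R};
  (* linear or convex quadratic *)
  gencost_convex : forall i, i \in gen ->
    (size (gencost i) <= 3)%N /\ 0 <= (gencost i)`_2
}.

Section Network.
Context {R : realType} (N : network R).
Local Notation bus := (bus N).
Local Notation line := (line N).

Definition joins (l : line) (i j : bus) : bool := ends l == [set i; j]%SET.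

Definition nbr (i : bus) : {set bus} := [set j | [exists l, joins l i j]]%SET.

Definition topology := {ffun line -> bool}.

(* Variables common to all the problems.  The entry [vc i i] is c_ii; the
   off-diagonal entries of [vp], [vq], [vc], [vs] only matter when [i] and [j]
   are the ends of a line, every constraint below being restricted to these. *)
Record opvars := OpVars {
  vpg : bus -> R;
  vqg : bus -> R;
  vp : bus -> bus -> R;
  vq : bus -> bus -> R;
  vc : bus -> bus -> R;
  vs : bus -> bus -> R;
  vx : line -> R
}.

Definition cost (z : opvars) : R := \sum_(i in gen N) (gencost i).[vpg z i].

Definition binary (z : opvars) : Prop := forall l, vx z l = 0 \/ vx z l = 1.

Definition has_topology (z : opvars) (y : topology) : Prop :=
  forall l, vx z l = (y l)%:R.

(* The first three groups of constraints, apart from integrality.  Here and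
   below, since [joins l i j = joins l j i], a constraint stated for all
   [l i j] with [joins l i j] is imposed for both orientations of [l]. *)
Record operating (z : opvars) : Prop := Operating {
  op_balance_p : forall i, vpg z i - pload i =
    gshunt i * vc z i i + \sum_(j in nbr i) vp z i j;
  op_balance_q : forall i, vqg z i - qload i =
    - bshunt i * vc z i i + \sum_(j in nbr i) vq z i j;
  op_voltage : forall i, vmin i ^+ 2 <= vc z i i <= vmax i ^+ 2;
  op_nogen : forall i, i \notin gen N -> vpg z i = 0 /\ vqg z i = 0;
  op_gen_p : forall i, i \in gen N -> pmin i <= vpg z i <= pmax i;
  op_gen_q : forall i, i \in gen N -> qmin i <= vqg z i <= qmax i;
  op_flow : forall l i j, joins l i j ->
    vp z i j ^+ 2 + vq z i j ^+ 2 <= smax i j ^+ 2;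
  op_c_sym : forall l i j, joins l i j -> vc z i j = vc z j i;
  op_s_skew : forall l i j, joins l i j -> vs z i j = - vs z j i
}.

Record ots_point := OtsPoint {
  ots_vars :> opvars;
  theta : bus -> R
}.

Record ots_feasible (z : ots_point) : Prop := OtsFeasible {
  ots_operating : operating z;
  ots_binary : binary z;
  ots_flow_p : forall l i j, joins l i j ->
    vp z i j = (- condG l * vc z i i + condG l * vc z i j
                - suscB l * vs z i j) * vx z l;
  ots_flow_q : forall l i j, joins l i j ->
    vq z i j = (suscB l * vc z i i - suscB l * vc z i j
                - condG l * vs z i j) * vx z l;
  ots_cone : forall l i j, joins l i j ->
    (vc z i j ^+ 2 + vs z i j ^+ 2 - vc z i i * vc z j j) * vx z l = 0;
  ots_angle : forall l i j, joins l i j ->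
    (theta z j - theta z i - atan2 (vs z i j) (vc z i j)) * vx z l = 0
}.

Definition ots_value : \bar R :=
  ereal_inf [set (cost z)%:E | z in [set z : ots_point | ots_feasible z]].

Record csbounds := CsBounds {
  cmin : bus -> bus -> R;
  cmax : bus -> bus -> R;
  smin_ : bus -> bus -> R;
  smax_ : bus -> bus -> R
}.

Definition valid_bounds (b : csbounds) : Prop :=
  forall z : ots_point, ots_feasible z ->
  forall l i j, joins l i j -> vx z l = 1 ->
    cmin b i j <= vc z i j <= cmax b i j /\
    smin_ b i j <= vs z i j <= smax_ b i j.

(* Linear inequality in (c, s, x): the value [lineq_lhs] below is at most
   [lin_rhs]. *)
Record lineq := LinEq {
  lin_c : bus -> bus -> R;
  lin_s : bus -> bus -> R;
  lin_x : line -> R;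
  lin_rhs : R
}.

Definition lineq_lhs (a : lineq) (c s : bus -> bus -> R) (x : line -> R) : R :=
  \sum_i lin_c a i i * c i i
  + \sum_i \sum_(j in nbr i) (lin_c a i j * c i j + lin_s a i j * s i j)
  + \sum_l lin_x a l * x l.

Definition satisfies (a : lineq) (c s : bus -> bus -> R) (x : line -> R) : Prop :=
  lineq_lhs a c s x <= lin_rhs a.

Definition line_on (x : line -> R) (i j : bus) : bool :=
  [exists l, joins l i j && (x l == 1)].

Definition switched_c (z : opvars) (i j : bus) : R :=
  if (i == j) || line_on (vx z) i j then vc z i j else 0.

Definition switched_s (z : opvars) (i j : bus) : R :=
  if line_on (vx z) i j then vs z i j else 0.

Definition ots_valid (a : lineq) : Prop :=
  forall z : ots_point, ots_feasible z ->
    satisfies a (switched_c z) (switched_s z) (vx z).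

(* [vcc i j] is c_ii^j. *)
Record rel_point := RelPoint {
  rel_vars :> opvars;
  vcc : bus -> bus -> R
}.

(* The constraints common to MISOCP(V, F) and SOCP(V). *)
Record relaxed (b : csbounds) (V : set lineq) (z : rel_point) : Prop := Relaxed {
  rel_operating : operating z;
  rel_flow_p : forall l i j, joins l i j ->
    vp z i j = - condG l * vcc z i j + condG l * vc z i j - suscB l * vs z i j;
  rel_flow_q : forall l i j, joins l i j ->
    vq z i j = suscB l * vcc z i j - suscB l * vc z i j - condG l * vs z i j;
  rel_c_bounds : forall l i j, joins l i j ->
    cmin b i j * vx z l <= vc z i j <= cmax b i j * vx z l;
  rel_s_bounds : forall l i j, joins l i j ->
    smin_ b i j * vx z l <= vs z i j <= smax_ b i j * vx z l;
  rel_cc_bounds : forall l i j, joins l i j ->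
    vmin i ^+ 2 * vx z l <= vcc z i j <= vmax i ^+ 2 * vx z l;
  rel_cc_link : forall l i j, joins l i j ->
    vc z i i - vmax i ^+ 2 * (1 - vx z l) <= vcc z i j
      <= vc z i i - vmin i ^+ 2 * (1 - vx z l);
  rel_cone : forall l i j, joins l i j ->
    vc z i j ^+ 2 + vs z i j ^+ 2 <= vcc z i j * vcc z j i;
  rel_cuts : forall a, V a -> satisfies a (vc z) (vs z) (vx z)
}.

Definition no_good (y : topology) (z : opvars) : Prop :=
  1 <= \sum_(l | y l) (1 - vx z l) + \sum_(l | ~~ y l) vx z l.

Definition misocp_feasible (b : csbounds) (V : set lineq) (F : {set topology})
    (z : rel_point) : Prop :=
  [/\ relaxed b V z, binary z & forall y, y \in F -> no_good y z].

Definition misocp_value (b : csbounds) (V : set lineq) (F : {set topology}) :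
    \bar R :=
  ereal_inf [set (cost z)%:E | z in [set z | misocp_feasible b V F z]].

Definition misocp_optimal (b : csbounds) (V : set lineq) (F : {set topology})
    (z : rel_point) : Prop :=
  misocp_feasible b V F z /\ (cost z)%:E = misocp_value b V F.

Definition socp_feasible (b : csbounds) (V : set lineq) (z : rel_point) : Prop :=
  relaxed b V z /\ forall l, 0 <= vx z l <= 1.

Definition socp_optimal (b : csbounds) (V : set lineq) (z : rel_point) : Prop :=
  socp_feasible b V z /\
  forall z' : rel_point, socp_feasible b V z' -> cost z <= cost z'.

(* The line set of a simple cycle. *)
Definition is_cycle (C : {set line}) : Prop :=
  exists r : seq bus,
    [/\ (2 < size r)%N, uniq r, cycle (fun i j => j \in nbr i) r &
        forall l, (l \in C) = [exists i, (i \in r) && joins l i (next r i)]].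

Definition even_degrees (S : {set line}) : Prop :=
  forall i : bus, ~~ odd #|[set l in S | i \in ends l]%SET|.

(* A basis, over the two-element field, of the cycle space. *)
Definition cycle_basis (Cs : {set {set line}}) : Prop :=
  (forall C, C \in Cs -> is_cycle C) /\
  forall S : {set line}, even_degrees S ->
    exists! A : {set {set line}},
      A \subset Cs /\
      forall l, (l \in S) = odd #|[set C in A | l \in C]%SET|.

(* One round of Phase I produces the set [W] from the current set [V].  When
   SOCP(V) is infeasible there is no solution to cut off. *)
Definition separation (b : csbounds) (V W : set lineq) : Prop :=
  (exists (z : rel_point) (Cs : {set {set line}})
      (cuts : {set line} -> set lineq),
    [/\ socp_optimal b V z, cycle_basis Cs,
        forall C, C \in Cs -> finite_set (cuts C),
        forall C a, C \in Cs -> cuts C a ->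
          ots_valid a /\ ~ satisfies a (vc z) (vs z) (vx z) &
        W = \bigcup_(C in [set` Cs]) cuts C]) \/
  ((forall z, ~ socp_feasible b V z) /\ W = set0).

(* [phase1 b n V]: the set of inequalities after [n] rounds can be [V]. *)
Inductive phase1 (b : csbounds) : nat -> set lineq -> Prop :=
| phase1_start : phase1 b 0 set0
| phase1_round n V W :
    phase1 b n V -> separation b V W -> phase1 b n.+1 (V `|` W).

(* [opf y] is the solution returned by the method for the topology [y], if
   any: it need not be optimal, and it may be [None] even if one exists. *)
Definition local_method (opf : topology -> option ots_point) : Prop :=
  forall y z, opf y = Some z -> ots_feasible z /\ has_topology z y.

Definition opf_value (opf : topology -> option ots_point) (y : topology) :
    \bar R :=
  if opf y is Some z then (cost z)%:E else +oo%E.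

(* Outcome of a solve of MISOCP(V, F): the optimal value [LB] and the set [P]
   of topologies found.  If MISOCP(V, F) is infeasible, the conditions give
   [LB = +oo] and [P] empty. *)
Definition misocp_solved (b : csbounds) (V : set lineq) (F : {set topology})
    (LB : \bar R) (P : {set topology}) : Prop :=
  [/\ LB = misocp_value b V F,
      forall y, y \in P ->
        exists z : rel_point, misocp_feasible b V F z /\ has_topology z y &
      (exists z, misocp_feasible b V F z) ->
        exists (z : rel_point) (y : topology),
          [/\ misocp_optimal b V F z, has_topology z y & y \in P]].

Definition update_incumbent (opf : topology -> option ots_point)
    (st : \bar R * option ots_point) (y : topology) :
    \bar R * option ots_point :=
  if (opf_value opf y < st.1)%E then (opf_value opf y, opf y) else st.

(* Trace of Phase II.  [tLB t] and [tP t] are defined by iteration [t], for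
   t >= 1; the other components are the values after iteration [t], the ones
   at [t = 0] being the values before the first iteration. *)
Record trace := Trace {
  tLB : nat -> \bar R;
  tP : nat -> {set topology};
  tF : nat -> {set topology};
  tUB : nat -> \bar R;
  tsol : nat -> option ots_point
}.

Definition stops (T2 : nat) (eps : R) (tr : trace) (t : nat) : Prop :=
  ((1 - eps)%:E * tUB tr t <= tLB tr t)%E \/ (T2 <= t)%N.

(* [T] is the number of iterations of Phase II at termination.  The
   topologies of [tP t] are processed in an arbitrary order [r]. *)
Record ots_algorithm (b : csbounds) (opf : topology -> option ots_point)
    (T1 T2 : nat) (eps : R) (V : set lineq) (tr : trace) (T : nat) : Prop :=
  OtsAlgorithm {
  alg_phase1 : phase1 b T1 V;
  alg_F0 : tF tr 0 = finset.set0;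
  alg_UB0 : tUB tr 0 = +oo%E;
  alg_sol0 : tsol tr 0 = None;
  alg_solve : forall t, (t < T)%N ->
    misocp_solved b V (tF tr t) (tLB tr t.+1) (tP tr t.+1);
  alg_update : forall t, (t < T)%N ->
    exists2 r : seq topology, perm_eq r (enum (tP tr t.+1)) &
      (tUB tr t.+1, tsol tr t.+1) =
        foldl (update_incumbent opf) (tUB tr t, tsol tr t) r;
  alg_forbid : forall t, (t < T)%N -> tF tr t.+1 = (tF tr t :|: tP tr t.+1)%SET;
  alg_T_gt0 : (0 < T)%N;
  alg_continue : forall t, (0 < t < T)%N -> ~ stops T2 eps tr t;
  alg_stop : stops T2 eps tr T
}.

End Network.

(* Main.v *)
Require Import Defs.
From mathcomp Require Import all_boot all_order all_algebra.
From mathcomp Require Import all_classical all_reals all_analysis.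

(** Lower bound.  No topology is forbidden in the first MISOCP, so it suffices
    that it relaxes OTS with the same objective.  An OTS solution becomes a
    solution of the relaxation when [c_ij] and [s_ij] are replaced by [0] on
    the lines that are off and [c_ii^j] is set to [c_ii x_ij]
    ([switched_off], [switched_off_feasible]).  The inequalities produced by
    Phase I hold at this point because each was separated as valid for OTS
    ([phase1_valid]).

    Upper bound.  The incumbent value only ever is [+oo] or the cost of a
    solution returned by the local method, which is feasible for OTS and so
    costs at least the optimal value ([incumbent_bound]). *)

Set Implicit Arguments.
Unset Strict Implicit.
Unset Printing Implicit Defensive.

Import Order.TTheory GRing.Theory Num.Theory.
Local Open Scope classical_set_scope.
Local Open Scope ring_scope.

Section Bounds.
Context {R : realType} {N : network R}.

Lemma joins_sym (l : line N) (i j : bus N) : joins l i j = joins l j i.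
Proof. by rewrite /joins finset.setUC. Qed.

Lemma joins_neq (l : line N) (i j : bus N) : joins l i j -> (i == j) = false.
Proof.
move=> /eqP e; have := ends_card l.
by rewrite e finset.cards2; case: (i == j).
Qed.

(** A pair of buses is joined by at most one line, so being on is a property
    of the pair. *)
Lemma line_on_joins (x : line N -> R) (l : line N) (i j : bus N) :
  joins l i j -> line_on x i j = (x l == 1).
Proof.
move=> lij; apply/existsP/idP => [[k /andP[kij]]|xl]; last first.
  by exists l; rewrite lij.
suff -> : k = l by [].
by apply: ends_inj; rewrite (eqP kij) (eqP lij).
Qed.

Definition switched_off (z : opvars N) : rel_point N :=
  RelPoint
    (OpVars (vpg z) (vqg z) (vp z) (vq z) (switched_c z) (switched_s z) (vx z))
    (fun i j => if line_on (vx z) i j then vc z i i else 0).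

Lemma switched_c_diag (z : opvars N) i : switched_c z i i = vc z i i.
Proof. by rewrite /switched_c eqxx. Qed.

Lemma switched_c_joins (z : opvars N) l i j : joins l i j ->
  switched_c z i j = if vx z l == 1 then vc z i j else 0.
Proof.
by move=> lij; rewrite /switched_c (joins_neq lij) (line_on_joins _ lij).
Qed.

Lemma switched_s_joins (z : opvars N) l i j : joins l i j ->
  switched_s z i j = if vx z l == 1 then vs z i j else 0.
Proof. by move=> lij; rewrite /switched_s (line_on_joins _ lij). Qed.

Lemma switched_off_operating (z : opvars N) :
  operating z -> operating (switched_off z).
Proof.
case=> bp bq bv ng gp gq fl cs ss; split => //=.
- by move=> i; rewrite switched_c_diag.
- by move=> i; rewrite switched_c_diag.
- by move=> i; rewrite switched_c_diag.
- move=> l i j lij; have lji : joins l j i by rewrite joins_sym.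
  by rewrite (switched_c_joins _ lij) (switched_c_joins _ lji) (cs _ _ _ lij).
- move=> l i j lij; have lji : joins l j i by rewrite joins_sym.
  rewrite (switched_s_joins _ lij) (switched_s_joins _ lji) (ss _ _ _ lij).
  by case: ifP => // _; rewrite oppr0.
Qed.

(** The bus balances see [c] only on the diagonal, which is kept.  For a line
    that is off, the OTS flows vanish, and the constraints on its [c_ij],
    [s_ij] and [c_ii^j] have all sides zero, except for
    [c_ii - vmax_i^2 <= c_ii^j <= c_ii - vmin_i^2], which is a voltage bound
    since [c_ii^j = 0].  For a line that is on, [c_ii^j = c_ii], so the flow
    equations are those of OTS, the cone constraint holds with equality, and
    the bounds hold because they were assumed valid. *)
Lemma switched_off_feasible (b : csbounds N) (V : set (lineq N))
    (z : ots_point N) :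
  valid_bounds b -> (forall a, V a -> ots_valid a) -> ots_feasible z ->
  misocp_feasible b V finset.set0 (switched_off z).
Proof.
move=> hb hV fz; have [oz bz fp fq cone _] := fz.
split=> //=; last by move=> y; rewrite finset.in_set0.
have zero_neq1 : (0 == 1 :> R) = false by rewrite eq_sym oner_eq0.
split=> /=; first exact: switched_off_operating.
- move=> l i j lij; rewrite (fp _ _ _ lij) (line_on_joins _ lij).
  rewrite (switched_c_joins _ lij) (switched_s_joins _ lij).
  by case: (bz l) => ->; rewrite ?eqxx ?zero_neq1 ?mulr1 ?mulr0 ?addr0 ?subr0.
- move=> l i j lij; rewrite (fq _ _ _ lij) (line_on_joins _ lij).
  rewrite (switched_c_joins _ lij) (switched_s_joins _ lij).
  by case: (bz l) => ->; rewrite ?eqxx ?zero_neq1 ?mulr1 ?mulr0 ?subr0.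
- move=> l i j lij; rewrite (switched_c_joins _ lij).
  case: (bz l) => xl; rewrite xl ?eqxx ?zero_neq1 ?mulr1 ?mulr0 ?lexx //.
  by have [] := hb _ fz _ _ _ lij xl.
- move=> l i j lij; rewrite (switched_s_joins _ lij).
  case: (bz l) => xl; rewrite xl ?eqxx ?zero_neq1 ?mulr1 ?mulr0 ?lexx //.
  by have [] := hb _ fz _ _ _ lij xl.
- move=> l i j lij; rewrite (line_on_joins _ lij).
  case: (bz l) => ->; rewrite ?eqxx ?zero_neq1 ?mulr1 ?mulr0 ?lexx //.
  exact: op_voltage.
- move=> l i j lij; rewrite switched_c_diag (line_on_joins _ lij).
  case: (bz l) => ->; rewrite ?eqxx ?zero_neq1 ?subrr ?subr0 ?mulr0 ?mulr1.
    by rewrite subr_le0 subr_ge0 andbC; exact: op_voltage.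
  by rewrite subr0 lexx.
- move=> l i j lij; have lji : joins l j i by rewrite joins_sym.
  rewrite (switched_c_joins _ lij) (switched_s_joins _ lij).
  rewrite (line_on_joins _ lij) (line_on_joins _ lji).
  have := cone _ _ _ lij.
  case: (bz l) => ->; rewrite ?eqxx ?zero_neq1 ?mulr1.
    by move=> _; rewrite expr0n /= addr0 mulr0.
  by move=> /subr0_eq ->.
- by move=> a Va; exact: hV.
Qed.

Lemma misocp_value_le_ots_value (b : csbounds N) (V : set (lineq N)) :
  valid_bounds b -> (forall a, V a -> ots_valid a) ->
  (misocp_value b V finset.set0 <= ots_value N)%E.
Proof.
move=> hb hV; apply: ereal_inf_le_tmp => _ [z fz <-].
by exists (switched_off z) => //; exact: switched_off_feasible.
Qed.

Lemma phase1_valid (b : csbounds N) n (V : set (lineq N)) :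
  phase1 b n V -> forall a, V a -> ots_valid a.
Proof.
elim=> [//|m U W _ IH sepW a [/IH //|Wa]].
case: sepW => [[z [Cs [cuts [_ _ _ valid WE]]]]|[_ W0]]; last by rewrite W0 in Wa.
by move: Wa; rewrite WE => -[C CCs /(valid _ _ CCs)[]].
Qed.

Section Incumbent.
Variable opf : topology N -> option (ots_point N).
Hypothesis opf_local : local_method opf.

Lemma ots_value_le_opf (y : topology N) : (ots_value N <= opf_value opf y)%E.
Proof.
rewrite /opf_value; case E: (opf y) => [z|]; last exact: leey.
by apply: ereal_inf_lbound; exists z => //; have [] := opf_local E.
Qed.

(** An update replaces the incumbent value by that of some [opf y], so the
    bound propagates along any list of topologies. *)
Lemma incumbent_bound (r : seq (topology N))
    (st : \bar R * option (ots_point N)) :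
  (ots_value N <= st.1)%E ->
  (ots_value N <= (foldl (update_incumbent opf) st r).1)%E.
Proof.
elim: r st => //= y r IH st hst; apply: IH.
by rewrite /update_incumbent; case: ifP => // _; exact: ots_value_le_opf.
Qed.

Lemma ots_value_le_UB (b : csbounds N) T1 T2 (eps : R) (V : set (lineq N))
    (tr : trace N) T :
  ots_algorithm b opf T1 T2 eps V tr T -> (ots_value N <= tUB tr T)%E.
Proof.
move=> alg; suff H t : (t <= T)%N -> (ots_value N <= tUB tr t)%E by exact: H.
elim: t => [_|t IH tT]; first by rewrite (alg_UB0 alg) leey.
have [r _ upd] := alg_update alg tT.
have -> : tUB tr t.+1 = (tUB tr t.+1, tsol tr t.+1).1 by [].
by rewrite upd; apply: incumbent_bound; exact: IH (ltnW tT).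
Qed.

End Incumbent.
End Bounds.

Theorem mainTheorem3 (R : realType) (N : network R) (b : csbounds N)
    (opf : topology N -> option (ots_point N)) (T1 T2 : nat) (eps : R)
    (V : set (lineq N)) (tr : trace N) (T : nat) :
  valid_bounds b ->
  local_method opf ->
  ots_algorithm b opf T1 T2 eps V tr T ->
  (tLB tr 1 <= ots_value N)%E /\ (ots_value N <= tUB tr T)%E.
Proof.
move=> hb hopf alg; split; last exact: ots_value_le_UB alg.
have [-> _ _] := alg_solve alg (alg_T_gt0 alg).
rewrite (alg_F0 alg); apply: misocp_value_le_ots_value => //.
exact: phase1_valid (alg_phase1 alg).
Qed.
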